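(* Let $\Omega_1\subset\mathbb{H}_s^n$ be real-path-connected, let $\Omega_2\subset\mathbb{H}_s^n$ be $\Omega_1$-stem-preserving, and let $f:\Omega_2\to\mathbb{H}$ be path-slice. Then the function $\mathscr{F}_{\Omega_1}^f:\Omega_1\to\mathbb{H}^{2\times 1}$ defined by $$\mathscr{F}_{\Omega_1}^f(q)=\begin{cases}F_{\Omega_1}^f(\gamma), & q\notin\mathbb{R}^n,\\ (f(q),0)^T, & q\in\mathbb{R}^n,\end{cases}$$ where, for $q\notin\mathbb{R}^n$, $\gamma\in\mathscr{P}(\mathbb{C}^n,\Omega_1)$ is any path with $\gamma^{\mathfrak{I}(q)}\subset\Omega_1$ and $\gamma^{\mathfrak{I}(q)}(1)=q$, is well-defined.
   Context: Let $n$ be a positive integer, $\mathbb{H}$ the quaternions, $\mathbb{S}:=\{I\in\mathbb{H}: I^2=-1\}$, $\mathbb{C}_I:=\mathbb{R}+\mathbb{R}I$, $\mathbb{C}_I^n:=(\mathbb{C}_I)^n$ and $\mathbb{H}_s^n:=\bigcup_{I\in\mathbb{S}}\mathbb{C}_I^n\subset\mathbb{H}^n$. For $I\in\mathbb{S}$ let $\Psi_i^I:\mathbb{C}^n\to\mathbb{C}_I^n$, $x+yi\mapsto x+yI$ ($x,y\in\mathbb{R}^n$). Let $\mathscr{P}(\mathbb{C}^n)$ be the set of continuous paths $\gamma:[0,1]\to\mathbb{C}^n$ with $\gamma(0)\in\mathbb{R}^n$; put $\gamma^I:=\Psi_i^I\circ\gamma$, and write $\gamma^I\subset\Omega$ if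 $\gamma^I([0,1])\subset\Omega$. For $\Omega\subset\mathbb{H}_s^n$ let $\mathscr{P}(\mathbb{C}^n,\Omega):=\{\gamma\in\mathscr{P}(\mathbb{C}^n):\exists I\in\mathbb{S},\ \gamma^I\subset\Omega\}$, and for $\gamma\in\mathscr{P}(\mathbb{C}^n)$ let $\mathbb{S}(\Omega,\gamma):=\{I\in\mathbb{S}:\gamma^I\subset\Omega\}$. A function $f:\Omega\to\mathbb{H}$ is path-slice if there is a function $F:\mathscr{P}(\mathbb{C}^n,\Omega)\to\mathbb{H}^{2\times1}$ with $f(\gamma^I(1))=(1,I)F(\gamma)$ for all $\gamma\in\mathscr{P}(\mathbb{C}^n,\Omega)$ and $I\in\mathbb{S}(\Omega,\gamma)$. $\Omega$ is real-path-connected if for every $q\in\Omega$ there are $\gamma\in\mathscr{P}(\mathbb{C}^n,\Omega)$ and $I\in\mathbb{S}(\Omega,\gamma)$ with $\gamma^I(1)=q$. $\Omega_2$ is $\Omega_1$-stem-preserving if (i) $|\mathbb{S}(\Omega_2,\gamma)|\geq 2$ for every $\gamma\in\mathscr{P}(\mathbb{C}^n,\Omega_1)$, and (ii) $|\mathbb{S}(\Omega_2,\alpha)\cap\mathbb{S}(\Omega_2,\beta)|\neq 1$ for all $\alpha,\beta\in\mathscr{P}(\mathbb{C}^n,\Omega_1)$ with $\alpha(1)=\beta(1)$. For $\gamma\in\mathscr{P}(\mathbb{C}^n,\Omega_1)$, $F_{\Omega_1}^f(\gamma):=\begin{pmatrix}1&I\\1&J\end{pmatrix}^{-1}\begin{pmatrix}f(\gamma^I(1))\\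 f(\gamma^J(1))\end{pmatrix}$ for any $I\neq J$ in $\mathbb{S}(\Omega_2,\gamma)$ (independent of the choice), where $\begin{pmatrix}1&I\\1&J\end{pmatrix}^{-1}=(I-J)^{-1}\begin{pmatrix}I&-J\\1&-1\end{pmatrix}$. $\mathfrak{I}:\mathbb{H}_s^n\to\mathbb{S}\cup\{0\}$ is defined by $\mathfrak{I}(q)=0$ if $q\in\mathbb{R}^n$, and otherwise $\mathfrak{I}(q)=\frac{q_\imath-\mathrm{Re}(q_\imath)}{|q_\imath-\mathrm{Re}(q_\imath)|}$ with $\imath$ the smallest index for which $q_\imath\notin\mathbb{R}$. ''Well-defined'' means: for $q\in\Omega_1\setminus\mathbb{R}^n$ such a path $\gamma$ exists and $F_{\Omega_1}^f(\gamma)$ does not depend on which such $\gamma$ is chosen; for $q\in\Omega_1\cap\mathbb{R}^n$ the value $f(q)$ makes sense, i.e. $q\in\Omega_2$. *)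

(* Defs.v *)
From HB Require Import structures.
From mathcomp Require Import all_boot all_order all_algebra.
From mathcomp Require Import all_classical all_reals all_analysis.
From mathcomp Require Import complex ring.

Set Implicit Arguments.
Unset Strict Implicit.
Unset Printing Implicit Defensive.

Import Order.TTheory GRing.Theory Num.Theory numFieldNormedType.Exports.

Local Open Scope classical_set_scope.
Local Open Scope ring_scope.

Record quat (R : Type) := Quat { qre : R; qi : R; qj : R; qk : R }.

Section Quaternions.
Context (R : rcfType).
Local Notation H := (quat R).

Definition quat_tuple (p : H) := (qre p, qi p, qj p, qk p).
Definition tuple_quat (t : R * R * R * R) : H :=
  let: (a, b, c, d) := t in Quat a b c d.
Lemma quat_tupleK : cancel quat_tuple tuple_quat.
Proof. by case. Qed.

HB.instance Definition _ := Choice.copy H (can_type quat_tupleK).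

Definition addq (p q : H) : H :=
  Quat (qre p + qre q) (qi p + qi q) (qj p + qj q) (qk p + qk q).
Definition oppq (p : H) : H := Quat (- qre p) (- qi p) (- qj p) (- qk p).

Lemma addqA : associative addq.
Proof. by move=> p q r; rewrite /addq /= !addrA. Qed.
Lemma addqC : commutative addq.
Proof. by move=> p q; congr Quat; rewrite addrC. Qed.
Lemma add0q : left_id (Quat 0 0 0 0) addq.
Proof. by case=> a b c d; rewrite /addq /= !add0r. Qed.
Lemma addNq : left_inverse (Quat 0 0 0 0) oppq addq.
Proof. by move=> p; rewrite /addq /= !addNr. Qed.

HB.instance Definition _ := GRing.isZmodule.Build H addqA addqC add0q addNq.

Definition mulq (p q : H) : H :=
  Quat (qre p * qre q - qi p * qi q - qj p * qj q - qk p * qk q)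
       (qre p * qi q + qi p * qre q + qj p * qk q - qk p * qj q)
       (qre p * qj q - qi p * qk q + qj p * qre q + qk p * qi q)
       (qre p * qk q + qi p * qj q - qj p * qi q + qk p * qre q).

Lemma mulqA : associative mulq.
Proof. by move=> p q r; congr Quat => /=; ring. Qed.
Lemma mul1q : left_id (Quat 1 0 0 0) mulq.
Proof. by case=> a b c d; congr Quat => /=; ring. Qed.
Lemma mulq1 : right_id (Quat 1 0 0 0) mulq.
Proof. by case=> a b c d; congr Quat => /=; ring. Qed.
Lemma mulqDl : left_distributive mulq +%R.
Proof. by move=> p q r; congr Quat => /=; ring. Qed.
Lemma mulqDr : right_distributive mulq +%R.
Proof. by move=> p q r; congr Quat => /=; ring. Qed.
Lemma oneq_neq0 : Quat 1 0 0 0 != 0 :> H.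
Proof. by apply/eqP => -[] /eqP; rewrite oner_eq0. Qed.

HB.instance Definition _ := GRing.Zmodule_isNzRing.Build H
  mulqA mul1q mulq1 mulqDl mulqDr oneq_neq0.

Definition normsq (p : H) : R := qre p ^+ 2 + qi p ^+ 2 + qj p ^+ 2 + qk p ^+ 2.
Definition absq (p : H) : R := Num.sqrt (normsq p).

Lemma normsq_eq0 p : (normsq p == 0) = (p == 0).
Proof.
case: p => a b c d; apply/eqP/eqP => [|[-> -> -> ->]]; last first.
  by rewrite /normsq /= expr0n /= !addr0.
rewrite /normsq /= => /eqP; rewrite !paddr_eq0 ?addr_ge0 ?sqr_ge0 // !sqrf_eq0.
by case/andP => /andP[/andP[/eqP-> /eqP->] /eqP->] /eqP->.
Qed.

Definition unitq : pred H := [pred p | p != 0].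
Definition invq (p : H) : H :=
  if p == 0 then 0
  else Quat (qre p / normsq p) (- qi p / normsq p)
            (- qj p / normsq p) (- qk p / normsq p).

Lemma mulVq : {in unitq, left_inverse 1 invq *%R}.
Proof.
move=> p; rewrite inE => p0; rewrite /invq (negPf p0).
have n0 : normsq p != 0 by rewrite normsq_eq0.
by congr Quat; rewrite /=; move: n0; rewrite /normsq => n0; field.
Qed.
Lemma mulqV : {in unitq, right_inverse 1 invq *%R}.
Proof.
move=> p; rewrite inE => p0; rewrite /invq (negPf p0).
have n0 : normsq p != 0 by rewrite normsq_eq0.
by congr Quat; rewrite /=; move: n0; rewrite /normsq => n0; field.
Qed.
Lemma unitqP (p q : H) : q * p = 1 /\ p * q = 1 -> unitq p.
Proof.
case=> qp _; apply/eqP => p0; move: qp; rewrite p0 mulr0 => /eqP.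
by rewrite eq_sym oner_eq0.
Qed.
Lemma invq_out : {in [predC unitq], invq =1 id}.
Proof. by move=> p; rewrite !inE negbK /invq => /eqP->; rewrite eqxx. Qed.

HB.instance Definition _ := GRing.NzRing_hasMulInverse.Build H
  mulVq mulqV unitqP invq_out.

Definition qreal (x : R) : H := Quat x 0 0 0.
Definition is_qreal (p : H) : bool := p == qreal (qre p).

Definition sphere : set H := [set I | I ^+ 2 = -1].

Definition row2 (a b : H) : 'rV[H]_2 := \row_j [:: a; b]`_j.
Definition col2 (a b : H) : 'cV[H]_2 := \col_i [:: a; b]`_i.
Definition mx22 (a b c d : H) : 'M[H]_2 :=
  \matrix_(i, j) (nth [::] [:: [:: a; b]; [:: c; d]] i)`_j.

(* The library's [invmx] needs a commutative ring, so the inverse of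
   [mx22 1 I 1 J] is given by its closed form; see [stem_mxV] and [stem_mxK]. *)
Definition stem_mx (I J : H) : 'M[H]_2 := mx22 1 I 1 J.
Definition stem_invmx (I J : H) : 'M[H]_2 := (I - J)^-1 *: mx22 I (- J) 1 (-1).

Lemma mulmx2E m n (A : 'M[H]_(m, 2)) (B : 'M[H]_(2, n)) i j :
  (A *m B) i j = A i 0 * B 0 j + A i 1 * B 1 j.
Proof.
rewrite mxE big_ord_recl big_ord1.
by have -> : lift ord0 ord0 = 1 :> 'I_2 by apply/val_inj.
Qed.

Lemma matrix2P (A B : 'M[H]_2) :
  A 0 0 = B 0 0 -> A 0 1 = B 0 1 -> A 1 0 = B 1 0 -> A 1 1 = B 1 1 -> A = B.
Proof.
have E (k : 'I_2) : k = 0 \/ k = 1.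
  by case: k => [[|[|//]] lt]; [left|right]; apply/val_inj.
by move=> *; apply/matrixP => i j; case: (E i) => ->; case: (E j) => ->.
Qed.

Lemma stem_mxV I J : sphere I -> sphere J -> I != J ->
  stem_invmx I J *m stem_mx I J = 1%:M.
Proof.
rewrite /sphere /= !expr2 => I2 J2 IJ.
have U : I - J \is a GRing.unit by rewrite -[_ \is a _]/(I - J != 0) subr_eq0.
apply: matrix2P; rewrite mulmx2E !mxE /= !(mulr1, mulrN1, mulNr, mulrN).
- by rewrite -mulrBr mulVr.
- by rewrite -!mulrA I2 J2 mulrN1 opprK addNr.
- by rewrite subrr.
- by rewrite -mulrBr mulVr.
Qed.

Lemma stem_mxK I J : sphere I -> sphere J -> I != J ->
  stem_mx I J *m stem_invmx I J = 1%:M.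
Proof.
rewrite /sphere /= !expr2 => I2 J2 IJ.
have U : I - J \is a GRing.unit by rewrite -[_ \is a _]/(I - J != 0) subr_eq0.
have cI : (I - J) * I = - (J * (I - J)).
  by rewrite mulrBl mulrBr I2 J2 opprB.
have cJ : (I - J) * J = - (I * (I - J)).
  by rewrite mulrBl mulrBr I2 J2 opprB opprK addrC.
have E1 : (I - J)^-1 * I = - (J * (I - J)^-1).
  apply: (mulrI U); apply: (mulIr U).
  by rewrite mulVKr // mulrN mulNr mulrA divrK // cJ opprK.
have E2 : (I - J)^-1 * J = - (I * (I - J)^-1).
  apply: (mulrI U); apply: (mulIr U).
  by rewrite mulVKr // mulrN mulNr mulrA divrK // cI opprK.
apply: matrix2P; rewrite mulmx2E !mxE /= !(mul1r, mulr1, mulrN1, mulNr, mulrN).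
- by rewrite E1 addrC -mulrBl divrr.
- by rewrite E2 opprK subrr.
- by rewrite E1 addNr.
- by rewrite E2 opprK -mulrBl divrr.
Qed.

End Quaternions.

Arguments sphere : clear implicits.
Notation "x %:H" := (qreal x) (at level 1, left associativity, format "x %:H").

(* [R[i]] packaged as a [numFieldType]: this is what gives row vectors over it
   their usual (norm) topology. *)
Definition Cplx (R : realType) : numFieldType := R[i].

Notation unit_itv R := (set_type (`[0, 1]%classic : set R)).

Section SlicePaths.
Context (R : realType) (n : nat).
Local Notation H := (quat R).
Local Notation Cn := 'rV[Cplx R]_n.
Local Notation Hn := 'rV[H]_n.

Lemma zero_unit_itv : (0 : R) \in (`[0, 1]%classic : set R).
Proof. by rewrite inE /= bound_itvE. Qed.
Lemma one_unit_itv : (1 : R) \in (`[0, 1]%classic : set R).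
Proof. by rewrite inE /= bound_itvE. Qed.
Definition t0 : unit_itv R := SigSub zero_unit_itv.
Definition t1 : unit_itv R := SigSub one_unit_itv.

Definition real_vectors : set Hn := [set q | forall k, exists x : R, q 0 k = x%:H].

Definition slice_plane (I : H) : set H := [set p | exists x y : R, p = x%:H + y%:H * I].
Definition slice_space (I : H) : set Hn := [set q | forall k, slice_plane I (q 0 k)].
Definition slice_cone : set Hn := \bigcup_(I in sphere R) slice_space I.

Definition Psi (I : H) (z : Cn) : Hn :=
  \row_k ((complex.Re (z 0 k))%:H + (complex.Im (z 0 k))%:H * I).

Definition paths : set (unit_itv R -> Cn) :=
  [set gam : unit_itv R -> Cn | continuous gam /\ forall k, complex.Im (gam t0 0 k) = 0].

Definition slice_path (gam : unit_itv R -> Cn) (I : H) : unit_itv R -> Hn :=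
  Psi I \o gam.

Definition slice_in (gam : unit_itv R -> Cn) (I : H) (Omega : set Hn) : Prop :=
  range (slice_path gam I) `<=` Omega.

Definition paths_in (Omega : set Hn) : set (unit_itv R -> Cn) :=
  [set gam | paths gam /\ exists2 I, sphere R I & slice_in gam I Omega].

Definition units_in (Omega : set Hn) (gam : unit_itv R -> Cn) : set H :=
  [set I | sphere R I /\ slice_in gam I Omega].

(* A function on [Omega] (resp. on [paths_in Omega]) is represented by a total
   function of which only the values on that set are ever constrained. *)
Definition path_slice (Omega : set Hn) (f : Hn -> H) : Prop :=
  exists F : (unit_itv R -> Cn) -> 'cV[H]_2,
    forall gam, paths_in Omega gam -> forall I, units_in Omega gam I ->
      (f (slice_path gam I t1))%:M = row2 1 I *m F gam.

Definition real_path_connected (Omega : set Hn) : Prop :=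
  forall q, Omega q -> exists gam I,
    [/\ paths_in Omega gam, units_in Omega gam I & slice_path gam I t1 = q].

Definition stem_preserving (Omega1 Omega2 : set Hn) : Prop :=
  (forall gam, paths_in Omega1 gam -> (`I_2 #<= units_in Omega2 gam)%card) /\
  (forall alp bet, paths_in Omega1 alp -> paths_in Omega1 bet ->
     alp t1 = bet t1 ->
     ~ (units_in Omega2 alp `&` units_in Omega2 bet #= `I_1)%card).

(* The value obtained from some pair of distinct units in [units_in Omega2 gam]
   (0 if there is no such pair); [stem_valueE] shows that the pair is irrelevant. *)
Definition stem_value (Omega2 : set Hn) (f : Hn -> H)
    (gam : unit_itv R -> Cn) : 'cV[H]_2 :=
  xget 0 [set v | exists I J : H,
    [/\ units_in Omega2 gam I, units_in Omega2 gam J, I <> J &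
        v = stem_invmx I J *m
              col2 (f (slice_path gam I t1)) (f (slice_path gam J t1))]].

Lemma stem_valueE (Omega2 : set Hn) f gam I J :
  path_slice Omega2 f -> paths gam ->
  units_in Omega2 gam I -> units_in Omega2 gam J -> I <> J ->
  stem_value Omega2 f gam =
    stem_invmx I J *m col2 (f (slice_path gam I t1)) (f (slice_path gam J t1)).
Proof.
move=> [F Ff] pg gI gJ IJ.
have pO : paths_in Omega2 gam by split=> //; exists I; case: gI.
have key K L : units_in Omega2 gam K -> units_in Omega2 gam L -> K <> L ->
    stem_invmx K L *m col2 (f (slice_path gam K t1)) (f (slice_path gam L t1))
    = F gam.
  move=> gK gL KL; have [sK sL] := (gK.1, gL.1).
  have -> : col2 (f (slice_path gam K t1)) (f (slice_path gam L t1)) =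
            stem_mx K L *m F gam.
    have e M : units_in Omega2 gam M ->
        f (slice_path gam M t1) = F gam 0 0 + M * F gam 1 0.
      move=> gM; have /matrixP/(_ 0 0) := Ff _ pO _ gM.
      by rewrite mulmx2E !mxE /= mulr1n mul1r.
    apply/matrixP => i j; rewrite (ord1 j) mulmx2E !mxE.
    by case: i => [[|[|//]] lt] /=; rewrite mul1r e.
  by rewrite mulmxA stem_mxV ?mul1mx //; apply/eqP.
rewrite /stem_value; case: xgetP => [v _ [K [L [gK gL KL ->]]]|].
  by rewrite !key.
move=> /(_ (stem_invmx I J *m
  col2 (f (slice_path gam I t1)) (f (slice_path gam J t1)))) [].
by exists I, J.
Qed.

(* [k] below is the smallest index with a non-real coordinate. *)
Definition frakI (q : Hn) : H :=
  if [pick k | ~~ is_qreal (q 0 k) &&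
               [forall j : 'I_n, (j < k)%N ==> is_qreal (q 0 j)]] is Some k
  then (q 0 k - (qre (q 0 k))%:H) / (absq (q 0 k - (qre (q 0 k))%:H))%:H
  else 0.

Definition admissible (Omega1 : set Hn) (q : Hn) (gam : unit_itv R -> Cn) : Prop :=
  [/\ paths_in Omega1 gam, slice_in gam (frakI q) Omega1 &
      slice_path gam (frakI q) t1 = q].

End SlicePaths.
Arguments real_vectors : clear implicits.
Arguments slice_cone : clear implicits.

(* Main.v *)
Require Import Defs.
From HB Require Import structures.
From mathcomp Require Import all_boot all_order all_algebra.
From mathcomp Require Import all_classical all_reals all_analysis.
From mathcomp Require Import complex ring lra.

Import Order.TTheory GRing.Theory Num.Theory numFieldNormedType.Exports.

Local Open Scope classical_set_scope.
Local Open Scope ring_scope.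

(** Two admissible paths [alp], [bet] for [q] end at the same point, because [q]
    determines the unit [frakI q].  Running along [alp] and then back along [bet]
    gives a path of Omega1 whose units in Omega2 are exactly the common units of
    [alp] and [bet], so the first stem-preserving condition alone provides two
    common units, and these compute both stem values.  Existence for non-real [q]
    follows by conjugating a path when the given unit is [- frakI q]. *)

(** * Imaginary units and coordinates along a unit *)

Lemma sphere_normsq (R : rcfType) (I : quat R) :
  sphere R I -> qre I = 0 /\ normsq I = 1.
Proof.
rewrite /sphere /= expr2; case: I => a b c d [] /= e1 e2 e3 e4.
have a0 : a = 0.
  (* If [a] were nonzero, the three imaginary components of [I ^+ 2 = -1] would force
     [b = c = d = 0], leaving [a * a = -1]. *)
  apply/eqP; apply: contraT => a_neq0.
  have z x : a * x + x * a = 0 -> x = 0.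
    move=> e; have : 2 * (a * x) = 0 by rewrite -e; ring.
    by move/eqP; rewrite !mulf_eq0 pnatr_eq0 (negPf a_neq0) => /eqP.
  have b0 : b = 0 by apply: z; lra.
  have c0 : c = 0 by apply: z; lra.
  have d0 : d = 0 by apply: z; lra.
  have := sqr_ge0 a; rewrite expr2 => h.
  by move: e1; rewrite b0 c0 d0; lra.
by split=> //; rewrite /normsq /= !expr2; move: e1; rewrite a0; lra.
Qed.

Lemma sphereN (R : rcfType) (I : quat R) : sphere R I -> sphere R (- I).
Proof. by rewrite /sphere /= sqrrN. Qed.

Lemma sphere_unit (R : rcfType) (I : quat R) :
  sphere R I -> I \is a GRing.unit.
Proof.
rewrite /sphere /= expr2 => I2; apply/unitrP; exists (- I).
by rewrite mulNr mulrN I2 opprK.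
Qed.

Lemma qrealN (R : rcfType) (x : R) : (- x)%:H = - x%:H.
Proof. by congr Quat => /=; rewrite oppr0. Qed.

Lemma qrealM (R : rcfType) (x : R) (p : quat R) :
  x%:H * p = Quat (x * qre p) (x * qi p) (x * qj p) (x * qk p).
Proof. by congr Quat; rewrite /= !mul0r !(subr0, addr0). Qed.

Lemma normsq_qrealM (R : rcfType) (x : R) (p : quat R) :
  normsq (x%:H * p) = x ^+ 2 * normsq p.
Proof. by rewrite qrealM /normsq /=; ring. Qed.

(** As [I] has no real part, the real part reads off [x]; then [I] is invertible and cancels from
    [y%:H * I]. *)
Lemma qrealD_inj (R : rcfType) (I : quat R) (x y x' y' : R) : sphere R I ->
  x%:H + y%:H * I = x'%:H + y'%:H * I -> x = x' /\ y = y'.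
Proof.
move=> sI e; have [I0 _] := sphere_normsq _ _ sI.
have xx' : x = x'.
  by have := congr1 (@qre R) e; rewrite /= I0 !(mul0r, mulr0, subr0, addr0).
split=> //; move: e; rewrite xx' => /addrI /(mulIr (sphere_unit _ _ sI)).
by case.
Qed.

Lemma Psi_inj (R : realType) (n : nat) (I : quat R) :
  sphere R I -> injective (@Psi R n I).
Proof.
move=> sI z w /matrixP e; apply/rowP => k.
have := e 0 k; rewrite !mxE => /(qrealD_inj _ _ _ _ _ _ sI).
by case: (z 0 k) (w 0 k) => a b [c d] /= [-> ->].
Qed.

(** Coordinates along [I] are unique, so a real value has zero imaginary parts and the unit is
    multiplied by 0. This lets a real endpoint be reached along any other unit. *)
Lemma Psi_real (R : realType) (n : nat) (I : quat R) (z : 'rV[Cplx R]_n) :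
  sphere R I -> real_vectors R n (Psi I z) -> forall J, Psi J z = Psi I z.
Proof.
move=> sI zR J; apply/rowP => k; rewrite !mxE.
have [x] := zR k; rewrite mxE => e.
have [_ ->] : complex.Re (z 0 k) = x /\ complex.Im (z 0 k) = 0.
  apply: (qrealD_inj _ I) => //; rewrite e.
  by rewrite -[0%:H]/(0 : quat R) mul0r addr0.
by rewrite -[0%:H]/(0 : quat R) !mul0r.
Qed.

(** The first non-real coordinate is [x + y I] with [y] nonzero, and its normalised imaginary part
    is [y / |y|] times [I]: the sign of [y] decides. *)
Lemma frakI_Psi (R : realType) (n : nat) (I : quat R) (z : 'rV[Cplx R]_n) :
  sphere R I -> ~ real_vectors R n (Psi I z) ->
  frakI (Psi I z) = I \/ frakI (Psi I z) = - I.
Proof.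
move=> sI zNR; have [I0 nI] := sphere_normsq _ _ sI.
rewrite /frakI; case: pickP => [k /andP[qkNR _]|noK].
  rewrite mxE; set x := complex.Re _; set y := complex.Im _.
  have re_q : qre (x%:H + y%:H * I) = x.
    by rewrite /= I0 !(mul0r, mulr0, subr0, addr0).
  have y_neq0 : y != 0.
    apply: contra qkNR => /eqP y0; rewrite mxE -/x -/y y0.
    by rewrite -[0%:H]/(0 : quat R) mul0r addr0 /is_qreal.
  rewrite re_q addrC addKr /absq normsq_qrealM nI mulr1 sqrtr_sqr.
  have ny_neq0 : `|y| != 0 by rewrite normr_eq0.
  have nyU : (`|y|)%:H \is a GRing.unit.
    by rewrite -[_ \is a _]/((`|y|)%:H != 0); apply/eqP => -[/eqP]; apply/negP.
  (* The division multiplies by the inverse on the right, so the real factor is moved there to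
     cancel. *)
  have -> : y%:H * I = I * y%:H.
    by rewrite qrealM; congr Quat; rewrite /= I0; ring.
  have [y0|y0|y0] := ltgtP y 0; last by rewrite y0 eqxx in y_neq0.
    have -> : y%:H = - (`|y|)%:H by rewrite ltr0_norm // qrealN opprK.
    by right; rewrite mulrN mulNr mulrK.
  by left; rewrite -{1}(gtr0_norm y0) mulrK.
(* If no first non-real coordinate is found, there is none at all: a minimal one would have been
   picked. *)
case: zNR => k; exists (qre (Psi I z 0 k)).
apply/eqP; apply: contraT => qkNR.
have [m mNR m_min] := @arg_minnP _ k (fun m => ~~ is_qreal (Psi I z 0 m)) val qkNR.
move: (noK m); rewrite mNR /= => /negP[]; apply/forallP => j.
by apply/implyP => jm; apply: contraTT jm => /m_min; rewrite -leqNgt.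
Qed.

(** * Conjugate paths and existence of admissible paths *)

Lemma paths_conj (R : realType) (n : nat) (gam : unit_itv R -> 'rV[Cplx R]_n) :
  paths gam -> paths (map_mx (@conjc R) \o gam).
Proof.
move=> [gam_cont gam0]; split=> [|k]; last first.
  by rewrite /= mxE; case: (gam _ 0 k) (gam0 k) => a b /= ->; rewrite oppr0.
(* Conjugation preserves the modulus of each entry, so it maps balls into balls of the same
   radius. *)
have conj_cont : continuous (map_mx (@conjc R) : 'rV[Cplx R]_n -> 'rV[Cplx R]_n).
  move=> z A /nbhs_ballP[e e0 eA]; apply/nbhs_ballP.
  exists e => // w [_ zw]; apply: eA; split=> // i j; have := zw i j.
  rewrite !mxE -!ball_normE /= -rmorphB /=.
  by case: (z i j - w i j) => a b; rewrite !normc_def /= sqrrN.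
by move=> t; apply: continuous_comp; [exact: gam_cont|exact: conj_cont].
Qed.

(** The sign changes of the imaginary part and of the unit cancel. *)
Lemma slice_path_conj (R : realType) (n : nat) (I : quat R)
    (gam : unit_itv R -> 'rV[Cplx R]_n) :
  slice_path (map_mx (@conjc R) \o gam) (- I) = slice_path gam I.
Proof.
apply/funext => t; apply/rowP => k; rewrite !mxE; congr (_ + _).
  by case: (gam t 0 k).
case: (gam t 0 k) => a b /=; rewrite !qrealM.
by congr Quat => /=; ring.
Qed.

Lemma sphere_frakI (R : realType) (n : nat) (Omega : set 'rV[quat R]_n) q :
  real_path_connected Omega -> Omega q -> ~ real_vectors R n q ->
  sphere R (frakI q).
Proof.
move=> conn Oq; have [gam [I [_ [sI _] <-]]] := conn q Oq => qNR.
by case: (frakI_Psi _ _ _ _ sI qNR) => ->; [|exact: sphereN].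
Qed.

Lemma admissible_ex (R : realType) (n : nat) (Omega : set 'rV[quat R]_n) q :
  real_path_connected Omega -> Omega q -> ~ real_vectors R n q ->
  exists gam, admissible Omega q gam.
Proof.
move=> conn Oq; have [gam [I [[pg _] [sI gI] <-]]] := conn q Oq => qNR.
case: (frakI_Psi _ _ _ _ sI qNR) => e.
  by exists gam; rewrite /admissible /= e; split=> //; split=> //; exists I.
exists (map_mx (@conjc R) \o gam); rewrite /admissible /= e /slice_in.
rewrite slice_path_conj; split=> //; split; first exact: paths_conj.
by exists (- I); [exact: sphereN|rewrite /slice_in slice_path_conj].
Qed.

(** * Joining two paths with a common endpoint *)

Lemma clamp_subproof (R : realType) (x : R) :
  Num.min 1 (Num.max 0 x) \in (`[0, 1]%classic : set R).
Proof.
by rewrite inE /= in_itv /= le_min ler01 le_max lexx ge_min lexx.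
Qed.

(** The retraction of the line onto the unit interval; it lets reparametrisations be written as
    plain real functions. *)
Definition clamp (R : realType) (x : R) : unit_itv R := SigSub (clamp_subproof R x).

Lemma clamp_continuous (R : realType) : continuous (@clamp R).
Proof.
apply: continuous_comp_initial => x.
apply: (@continuous_min _ _ (cst 1) (fun x : R => Num.max 0 x)).
  exact: cvg_cst.
by apply: (@continuous_max _ _ (cst 0) id); [exact: cvg_cst|exact: cvg_id].
Qed.

Lemma clamp_ge1 (R : realType) (x : R) : 1 <= x -> clamp R x = t1 R.
Proof.
move=> x1; apply/val_inj => /=.
by rewrite (max_r (le_trans ler01 x1)) min_l.
Qed.

Lemma clamp_le0 (R : realType) (x : R) : x <= 0 -> clamp R x = t0 R.
Proof. by move=> x0; apply/val_inj => /=; rewrite max_l // min_r. Qed.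

Lemma clamp_id (R : realType) (x : R) :
  0 <= x <= 1 -> val (clamp R x) = x.
Proof. by case/andP => x0 x1; rewrite /= max_r // min_r. Qed.

Lemma unit_itv_val (R : realType) (t : unit_itv R) : 0 <= val t <= 1.
Proof. by have := set_valP t; rewrite /= in_itv. Qed.

Lemma clamp_val (R : realType) (t : unit_itv R) : clamp R (val t) = t.
Proof. by apply/val_inj; rewrite clamp_id // unit_itv_val. Qed.

(* [alp] followed by [bet] run backwards: at each time at least one of the first
   two terms equals the common endpoint, which the third one cancels. *)
Definition there_and_back (R : realType) (n : nat)
    (alp bet : unit_itv R -> 'rV[Cplx R]_n) (t : unit_itv R) : 'rV[Cplx R]_n :=
  alp (clamp R (2 * val t)) + bet (clamp R (2 - 2 * val t)) - alp (t1 R).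

Lemma there_and_back_fst (R : realType) (n : nat)
    (alp bet : unit_itv R -> 'rV[Cplx R]_n) t :
  alp (t1 R) = bet (t1 R) -> val t <= 2^-1 ->
  there_and_back R n alp bet t = alp (clamp R (2 * val t)).
Proof.
move=> end_eq ht; rewrite /there_and_back (clamp_ge1 R (2 - _)); last by lra.
by rewrite end_eq addrK.
Qed.

Lemma there_and_back_snd (R : realType) (n : nat)
    (alp bet : unit_itv R -> 'rV[Cplx R]_n) t :
  alp (t1 R) = bet (t1 R) -> 2^-1 <= val t ->
  there_and_back R n alp bet t = bet (clamp R (2 - 2 * val t)).
Proof.
move=> end_eq ht; rewrite /there_and_back (clamp_ge1 R (2 * _)); last by lra.
by rewrite (addrC (alp _)) addrK.
Qed.

Lemma there_and_back_paths (R : realType) (n : nat)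
    (alp bet : unit_itv R -> 'rV[Cplx R]_n) :
  alp (t1 R) = bet (t1 R) ->
  paths alp -> paths bet -> paths (there_and_back R n alp bet).
Proof.
move=> end_eq [alp_cont alp0] [bet_cont _]; split=> [t|k]; last first.
  (* Time 0 lies in the first half, so the starting point is that of [alp], which is real. *)
  by rewrite (there_and_back_fst _ _ _ _ _ end_eq) /= ?invr_ge0 ?ler0n //
             mulr0 clamp_le0.
have val_cont : {for t, continuous (val : unit_itv R -> R)}.
  exact: initial_continuous.
have fst_cont : {for t, continuous (fun s : unit_itv R => clamp R (2 * val s))}.
  apply: (@continuous_comp _ _ _ (val : unit_itv R -> R)
    (fun x => clamp R (2 * x))) => //.
  apply: continuous_comp; last exact: clamp_continuous.
  exact: mulrl_continuous.
have snd_cont :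
    {for t, continuous (fun s : unit_itv R => clamp R (2 - 2 * val s))}.
  apply: (@continuous_comp _ _ _ (val : unit_itv R -> R)
    (fun x => clamp R (2 - 2 * x))) => //.
  apply: (@continuous_comp _ _ _ (fun x : R => 2 - 2 * x));
    last exact: clamp_continuous.
  by apply: cvgB; [exact: cvg_cst|exact: mulrl_continuous].
have FF : Filter (nbhs t) by exact: nbhs_filter.
apply: (@cvgB _ _ _ _ FF); last exact: cvg_cst.
apply: (@cvgD _ _ _ _ FF).
  by apply: (continuous_comp fst_cont); exact: alp_cont.
by apply: (continuous_comp snd_cont); exact: bet_cont.
Qed.

(** The image of the joined path is the union of the two images: each half covers one of them. *)
Lemma slice_in_there_and_back (R : realType) (n : nat)
    (alp bet : unit_itv R -> 'rV[Cplx R]_n)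
    (I : quat R) (Omega : set 'rV[quat R]_n) :
  alp (t1 R) = bet (t1 R) ->
  slice_in (there_and_back R n alp bet) I Omega <->
  slice_in alp I Omega /\ slice_in bet I Omega.
Proof.
move=> end_eq; split=> [gO|[aO bO] _ [t _ <-]]; last first.
  have [ht|/ltW ht] := leP (val t) 2^-1.
    apply: aO; exists (clamp R (2 * val t)) => //.
    by rewrite /slice_path /= (there_and_back_fst _ _ _ _ _ end_eq).
  apply: bO; exists (clamp R (2 - 2 * val t)) => //.
  by rewrite /slice_path /= (there_and_back_snd _ _ _ _ _ end_eq).
split=> _ [t _ <-]; have /andP[t_ge0 t_le1] := unit_itv_val R t.
  have v : val (clamp R (val t / 2)) = val t / 2 by rewrite clamp_id //; lra.
  apply: gO; exists (clamp R (val t / 2)) => //.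
  rewrite /slice_path /= (there_and_back_fst _ _ _ _ _ end_eq) v; last by lra.
  by rewrite mulrC divfK ?pnatr_eq0 // clamp_val.
(* The time [1 - t / 2] solves [2 - 2 * s = t]: there the return journey passes [bet t]. *)
have v : val (clamp R (1 - val t / 2)) = 1 - val t / 2.
  by rewrite clamp_id //; lra.
apply: gO; exists (clamp R (1 - val t / 2)) => //.
rewrite /slice_path /= (there_and_back_snd _ _ _ _ _ end_eq) v; last by lra.
by rewrite (_ : 2 - 2 * (1 - val t / 2) = val t) ?clamp_val //; field.
Qed.

(** * Independence of the path and conclusion *)

Lemma card_ge2_ex (T : Type) (A : set T) :
  (`I_2 #<= A)%card -> exists x y, [/\ A x, A y & x <> y].
Proof.
move=> /card_leP[f].
have i0 : 0%N \in `I_2 by rewrite inE.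
have i1 : 1%N \in `I_2 by rewrite inE.
exists (val (f (SigSub i0))), (val (f (SigSub i1))).
split; [exact: set_valP|exact: set_valP|].
by move=> /val_inj /inj; rewrite !inE => /(_ I I).
Qed.

Lemma admissible_stem_value (R : realType) (n : nat)
    (Omega1 Omega2 : set 'rV[quat R]_n) f q alp bet :
  (forall gam, paths_in Omega1 gam -> (`I_2 #<= units_in Omega2 gam)%card) ->
  path_slice Omega2 f -> sphere R (frakI q) ->
  admissible Omega1 q alp -> admissible Omega1 q bet ->
  stem_value Omega2 f alp = stem_value Omega2 f bet.
Proof.
move=> two slice_f sq [[pa _] aO a1] [[pb _] bO b1].
have end_eq : alp (t1 R) = bet (t1 R).
  by apply: (Psi_inj _ _ _ sq); exact: etrans a1 (esym b1).
have abO : paths_in Omega1 (there_and_back R n alp bet).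
  split; first exact: there_and_back_paths.
  by exists (frakI q) => //; apply/slice_in_there_and_back.
have [I [J [[sI abI] [sJ abJ] IJ]]] := card_ge2_ex _ _ (two _ abO).
have [aI bI] := (slice_in_there_and_back _ _ _ _ _ _ end_eq).1 abI.
have [aJ bJ] := (slice_in_there_and_back _ _ _ _ _ _ end_eq).1 abJ.
(* With one pair of units for both paths, the two stem values are the same expression in the common
   endpoint. *)
by rewrite !(@stem_valueE _ _ Omega2 f _ I J) // /slice_path /= end_eq.
Qed.

Theorem proposition3p11 (R : realType) (n : nat) (n_gt0 : (0 < n)%N)
  (Omega1 Omega2 : set 'rV[quat R]_n) (f : 'rV[quat R]_n -> quat R)
  (sub1 : Omega1 `<=` slice_cone R n) (sub2 : Omega2 `<=` slice_cone R n)
  (conn1 : real_path_connected Omega1)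
  (stem : stem_preserving Omega1 Omega2)
  (slice_f : path_slice Omega2 f) :
  exists scrF : 'rV[quat R]_n -> 'cV[quat R]_2,
    forall q, Omega1 q ->
      (~ real_vectors R n q ->
         (exists gam, admissible Omega1 q gam) /\
         (forall gam, admissible Omega1 q gam -> scrF q = stem_value Omega2 f gam)) /\
      (real_vectors R n q -> Omega2 q /\ scrF q = col2 (f q) 0).
Proof.
case: stem => two _.
(* At non-real points [xget] selects some admissible path; its default, the zero path, is never
   returned on [Omega1] since one exists. *)
exists (fun q => if `[< real_vectors R n q >] then col2 (f q) 0
  else stem_value Omega2 f (xget (fun=> 0) (admissible Omega1 q))).
move=> q Oq; split=> [qNR|qR].
  have adm := admissible_ex _ _ _ _ conn1 Oq qNR; split=> // gam gadm.
  rewrite asboolF //; apply: (admissible_stem_value R n Omega1 _ f q) => //.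
    exact: (sphere_frakI _ _ _ _ conn1 Oq qNR).
  exact: xgetPex adm.
split; last by rewrite asboolT.
(* A path of [Omega1] ending at the real point [q] lies in [Omega2] along some unit [J], and its
   endpoint along [J] is still [q]. *)
have [gam [I [gO [sI _] gq]]] := conn1 q Oq.
have [J [_ [[_ gJ] _ _]]] := card_ge2_ex _ _ (two _ gO).
move: qR; rewrite -gq => /(Psi_real _ _ _ _ sI)/(_ J) e.
by apply: gJ; exists (t1 R).
Qed.
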